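(* Let $n_1>n_2\ge1$ and $k_1,k_2\ge1$ be integers with $k_1n_1+k_2n_2=n$, $\gcd(n_1,n_2)=1$ and $\gcd(k_1,k_2)=1$. Then there exists a positive integer $r$ with $\gcd(r,n)=1$ such that $(n,r)\times[1,0]$ is an ancestor of $(n_1,n_2)\times[k_1,k_2]$ under the extended Farey map.
   Context: $(a_1,a_2)\times[c_1,c_2]$ denotes the partition of $c_1a_1+c_2a_2$ with $c_1$ parts $a_1$ and $c_2$ parts $a_2$. $\tilde F_0((a_1,a_2)\times[c_1,c_2])=(a_2,a_1-a_2)\times[c_1+c_2,c_1]$ and $\tilde F_1((a_1,a_2)\times[c_1,c_2])=(a_1-a_2,a_2)\times[c_1,c_1+c_2]$. The extended Farey map $\tilde F$ applies $\tilde F_0$ when $a_2\ge a_1-a_2$ and $\tilde F_1$ when $a_1-a_2\ge a_2$ (either when equal). $\lambda$ is an ancestor of $\mu$ if $\mu$ is obtained from $\lambda$ by finitely many applications of $\tilde F$. *)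

(* Defs.v *)
From mathcomp Require Import all_boot.
From Stdlib Require Import Relations.

Set Implicit Arguments.
Unset Strict Implicit.
Unset Printing Implicit Defensive.

(* [TwoSize a1 a2 c1 c2] is the symbol (a1, a2) x [c1, c2], i.e. the partition
   of c1 * a1 + c2 * a2 with c1 parts a1 and c2 parts a2.  Both sizes are kept
   even when a multiplicity is 0: (n, r) x [1, 0] is the partition (n) of n
   together with the size r, on which its image under the Farey map depends. *)
Record two_size := TwoSize {
  size1 : nat;
  size2 : nat;
  mult1 : nat;
  mult2 : nat
}.

Definition farey0 (s : two_size) : two_size :=
  let: TwoSize a1 a2 c1 c2 := s in TwoSize a2 (a1 - a2) (c1 + c2) c1.

Definition farey1 (s : two_size) : two_size :=
  let: TwoSize a1 a2 c1 c2 := s in TwoSize (a1 - a2) a2 c1 (c1 + c2).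

(* The extended Farey map, as a relation because both branches are allowed when
   a2 = a1 - a2.  The guard a2 <= a1 makes the truncated subtractions exact. *)
Inductive farey : relation two_size :=
| Farey0 s of size2 s <= size1 s & size1 s - size2 s <= size2 s :
    farey s (farey0 s)
| Farey1 s of size2 s <= size1 s & size2 s <= size1 s - size2 s :
    farey s (farey1 s).

Definition ancestor : relation two_size := clos_refl_trans two_size farey.

(* Main.v *)
Require Import Defs.
From mathcomp Require Import all_boot.
From Stdlib Require Import Relations.

(** Run the Farey map backwards.  Since n2 < n1, the inverse branches send
    (n1, n2) x [k1, k2] to (n1 + n2, n1) x [k2, k1 - k2] when k2 <= k1 and to
    (n1 + n2, n2) x [k1, k2 - k1] when k1 <= k2.  On the multiplicities this is
    the subtractive Euclidean algorithm, so it ends at [1, 0]; the partitioned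
    integer and the gcd of the sizes do not change along the way. *)

(** At sizes [(a + b, a)] the second guard of [Farey0] is exactly [b <= a]. *)
Lemma farey0_inv (a b c d : nat) : b <= a -> d <= c ->
  farey (TwoSize (a + b) a d (c - d)) (TwoSize a b c d).
Proof.
move=> le_ba le_dc.
have := @Farey0 (TwoSize (a + b) a d (c - d)).
by rewrite /farey0 /= addKn subnKC //; apply; rewrite // leq_addr.
Qed.

Lemma farey1_inv (a b c d : nat) : b <= a -> c <= d ->
  farey (TwoSize (a + b) b c (d - c)) (TwoSize a b c d).
Proof.
move=> le_ba le_cd.
have := @Farey1 (TwoSize (a + b) b c (d - c)).
by rewrite /farey1 /= addnK subnKC //; apply; rewrite // leq_addl.
Qed.

(* Multiplicity 0 is allowed for k2, as it occurs at the end of the descent. *)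
Lemma ancestor_of_coprime (n1 n2 k1 k2 : nat) :
  0 < n2 -> n2 < n1 -> 0 < k1 -> coprime n1 n2 -> coprime k1 k2 ->
  exists r : nat, [/\ 0 < r, coprime r (k1 * n1 + k2 * n2) &
    ancestor (TwoSize (k1 * n1 + k2 * n2) r 1 0) (TwoSize n1 n2 k1 k2)].
Proof.
(* Strong induction on [k1 + k2], which drops by the smaller multiplicity. *)
have [m] := ubnP (k1 + k2); elim: m n1 n2 k1 k2 => // m IHm n1 n2 k1 k2.
rewrite ltnS => le_km n2_gt0 lt_n21 k1_gt0 co_n.
have [-> | k2_gt0] := posnP k2.
  (* Coprimality to 0 forces [k1 = 1]: the integer is [n1], and [n2] serves as [r]. *)
  rewrite /coprime gcdn0 => /eqP->; exists n2.
  by rewrite mul1n mul0n addn0 gcdnC; split=> //; apply: rt_refl.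
(* Either way the new first multiplicity is the smaller of [k1] and [k2], hence positive; a tie
   makes the second one 0. *)
have [le_k21 | /ltnW le_k12] := leqP k2 k1 => co_k.
- have lt_m : k2 + (k1 - k2) < m.
    by rewrite subnKC //; apply: leq_trans le_km; rewrite -addn1 leq_add2l.
  have [] := IHm (n1 + n2) n1 k2 (k1 - k2) lt_m => //.
  + exact: ltn_trans lt_n21.
  + by rewrite -addn1 leq_add2l.
  + by rewrite coprime_sym /coprime gcdnDl.
  + by rewrite /coprime -gcdnDl subnKC // gcdnC.
  have -> : k2 * (n1 + n2) + (k1 - k2) * n1 = k1 * n1 + k2 * n2.
    by rewrite mulnDr addnAC -mulnDl subnKC.
  move=> r [r_gt0 co_r anc]; exists r; split=> //.
  by apply: rt_trans anc _; apply: rt_step; apply: farey0_inv; rewrite // ltnW.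
- have lt_m : k1 + (k2 - k1) < m.
    by rewrite subnKC //; apply: leq_trans le_km; rewrite -add1n leq_add2r.
  have [] := IHm (n1 + n2) n2 k1 (k2 - k1) lt_m => //.
  + by rewrite -add1n leq_add2r (ltn_trans n2_gt0).
  + by rewrite coprime_sym /coprime gcdnDr gcdnC.
  + by rewrite /coprime -gcdnDl subnKC.
  have -> : k1 * (n1 + n2) + (k2 - k1) * n2 = k1 * n1 + k2 * n2.
    by rewrite mulnDr -addnA -mulnDl subnKC.
  move=> r [r_gt0 co_r anc]; exists r; split=> //.
  by apply: rt_trans anc _; apply: rt_step; apply: farey1_inv; rewrite // ltnW.
Qed.

Theorem theorem4p18 (n n1 n2 k1 k2 : nat)
    (hn2 : 1 <= n2) (hn12 : n2 < n1) (hk1 : 1 <= k1) (hk2 : 1 <= k2)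
    (hn : k1 * n1 + k2 * n2 = n)
    (hgn : gcdn n1 n2 = 1) (hgk : gcdn k1 k2 = 1) :
  exists r : nat, 0 < r /\ gcdn r n = 1 /\
    ancestor (TwoSize n r 1 0) (TwoSize n1 n2 k1 k2).
Proof.
have [||r [r_gt0 /eqP co_r anc]] := ancestor_of_coprime n1 n2 k1 k2 hn2 hn12 hk1.
- exact/eqP.
- exact/eqP.
by exists r; rewrite -hn.
Qed.
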